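(* Let $\mathbb{B}$ be a non-trivial complete Boolean algebra (i.e. $0\neq 1$). Then the following relations hold between convergences on $\mathbb{B}$: $$\lambda_{\mathrm{s}}\leq \lambda_{\mathrm{ls}},\quad \lambda_{\mathrm{s}}\leq\lambda_{\mathrm{li}},\quad \lambda_{\mathrm{s}}\leq \lambda_{\mathrm{s}}^*=\lim\nolimits_{\mathcal{O}_{\lambda_{\mathrm{s}}}},$$ $$\lambda_{\mathrm{ls}}\leq\lambda_{\mathrm{ls}}^*\leq \lim\nolimits_{\mathcal{O}_{\lambda_{\mathrm{ls}}}},\qquad \lambda_{\mathrm{li}}\leq\lambda_{\mathrm{li}}^*\leq \lim\nolimits_{\mathcal{O}_{\lambda_{\mathrm{li}}}},$$ $$\lambda_{\mathrm{s}}^*\leq \lambda_{\mathrm{ls}}^*,\quad \lambda_{\mathrm{s}}^*\leq\lambda_{\mathrm{li}}^*,\quad \lambda_{\mathrm{s}}^*\leq \lim\nolimits_{\mathcal{O}_{\mathrm{lsi}}},\quad \lim\nolimits_{\mathcal{O}_{\mathrm{lsi}}}\leq \lim\nolimits_{\mathcal{O}_{\lambda_{\mathrm{ls}}}},\quad \lim\nolimits_{\mathcal{O}_{\mathrm{lsi}}}\leq\lim\nolimits_{\mathcal{O}_{\lambda_{\mathrm{li}}}},$$ and the following inclusions hold between topologies on $\mathbb{B}$: $$\mathcal{O}_{\lambda_{\mathrm{ls}}}\subseteq \mathcal{O}_{\mathrm{lsi}},\quad \mathcal{O}_{\lambda_{\mathrm{li}}}\subseteq \mathcal{O}_{\mathrm{lsi}},\quad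 \mathcal{O}_{\mathrm{lsi}}\subseteq \mathcal{O}_{\lambda_{\mathrm{s}}}.$$ In addition: (a) $\lambda_{\mathrm{ls}}\cap\lambda_{\mathrm{li}}=\lambda_{\mathrm{s}}$, $\ \lambda_{\mathrm{ls}}^*\cap\lambda_{\mathrm{li}}^*=\lambda_{\mathrm{s}}^*$, and $\ \lim_{\mathcal{O}_{\lambda_{\mathrm{ls}}}}\cap\lim_{\mathcal{O}_{\lambda_{\mathrm{li}}}}=\lim_{\mathcal{O}_{\mathrm{lsi}}}$; (b) $\lambda_{\mathrm{s}}<\lambda_{\mathrm{ls}}$ and $\lambda_{\mathrm{s}}<\lambda_{\mathrm{li}}$; $\ \lambda_{\mathrm{s}}^*<\lambda_{\mathrm{ls}}^*$ and $\lambda_{\mathrm{s}}^*<\lambda_{\mathrm{li}}^*$; $\ \lim_{\mathcal{O}_{\mathrm{lsi}}}<\lim_{\mathcal{O}_{\lambda_{\mathrm{ls}}}}$ and $\lim_{\mathcal{O}_{\mathrm{lsi}}}<\lim_{\mathcal{O}_{\lambda_{\mathrm{li}}}}$; and $\mathcal{O}_{\mathrm{lsi}}\supsetneq\mathcal{O}_{\lambda_{\mathrm{ls}}}$ and $\mathcal{O}_{\mathrm{lsi}}\supsetneq\mathcal{O}_{\lambda_{\mathrm{li}}}$.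
   Context: A convergence on a non-empty set $X$ is a map $\lambda:X^\omega\to P(X)$. For convergences, $\lambda_1\leq\lambda_2$ means $\lambda_1(x)\subseteq\lambda_2(x)$ for all $x\in X^\omega$; $\lambda_1<\lambda_2$ means $\lambda_1\leq\lambda_2$ and $\lambda_1\neq\lambda_2$; and $(\lambda_1\cap\lambda_2)(x)=\lambda_1(x)\cap\lambda_2(x)$. For a topology $\mathcal{O}$ on $X$, $\lim_{\mathcal{O}}$ is the convergence for which $\lim_{\mathcal{O}}(x)$ is the set of all $a\in X$ such that each neighborhood of $a$ contains all but finitely many members of the sequence $x$. For each convergence $\lambda$, $\mathcal{O}_\lambda$ denotes the (unique) maximal topology $\mathcal{O}$ on $X$ with $\lambda\leq\lim_{\mathcal{O}}$. Further, $\lambda^*$ is defined by $\lambda^*(x)=\bigcap_{f}\bigcup_{g}\lambda(x\circ f\circ g)$, where $f,g$ range over all strictly increasing functions $\omega\to\omega$. On a complete Boolean algebra $\mathbb{B}$, for $x=\langle x_n:n\in\omega\rangle\in\mathbb{B}^\omega$ let $\liminf x=\bigvee_{k\in\omega}\bigwedge_{n\geq k}x_n$ and $\limsup x=\bigwedge_{k\in\omega}\bigvee_{n\geq k}x_n$, and define convergences on $\mathbb{B}$ by $\lambda_{\mathrm{ls}}(x)=\{b\in\mathbb{B}: b\geq\limsup x\}$, $\lambda_{\mathrm{li}}(x)=\{b\in\mathbb{B}: b\leq\liminf x\}$, and $\lambda_{\mathrm{s}}(x)=\{a\}$ if $\liminf x=\limsup x=a$, while $\lambda_{\mathrm{s}}(x)=\emptyset$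 if $\liminf x<\limsup x$. The topology $\mathcal{O}_{\mathrm{lsi}}$ is the minimal topology on $\mathbb{B}$ containing $\mathcal{O}_{\lambda_{\mathrm{ls}}}\cup\mathcal{O}_{\lambda_{\mathrm{li}}}$. *)

(* Defs.v *)
From mathcomp Require Import all_boot all_order.
From mathcomp Require Import boolp classical_sets filter.

Set Implicit Arguments.
Unset Strict Implicit.
Unset Printing Implicit Defensive.

Import Order.TTheory.

Local Open Scope classical_set_scope.

Definition convergence (X : Type) : Type := (nat -> X) -> set X.

Section Convergence.
Context {X : Type}.
Implicit Types (l : convergence X) (O : set (set X)).

Definition conv_le l1 l2 : Prop := forall x, l1 x `<=` l2 x.

Definition conv_lt l1 l2 : Prop := conv_le l1 l2 /\ l1 <> l2.

Definition conv_cap l1 l2 : convergence X := fun x => l1 x `&` l2 x.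

Definition strictly_increasing : set (nat -> nat) :=
  [set f | {homo f : m n / (m < n)%N}].

Definition conv_star l : convergence X := fun x =>
  \bigcap_(f in strictly_increasing)
    \bigcup_(g in strictly_increasing) l (x \o f \o g).

(* A topology is represented by its family of open sets, since several
   topologies on the same carrier have to be compared; the empty set is open as
   the union of the empty family. *)
Definition is_topology O : Prop :=
  [/\ O setT, setI_closed O &
      forall F : set (set X), F `<=` O -> O (\bigcup_(U in F) U)].

Definition top_nbhs O (a : X) : set (set X) :=
  [set U | exists V, [/\ O V, V a & V `<=` U]].

Definition top_lim O : convergence X := fun x =>
  [set a | forall U, top_nbhs O a U -> \forall n \near \oo, U (x n)].

Definition maximal_topology l : set (set (set X)) :=
  [set O | [/\ is_topology O, conv_le l (top_lim O) &
    forall O', is_topology O' -> conv_le l (top_lim O') ->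
      O `<=` O' -> O' = O]].

(* The default value is irrelevant: see [maximal_topologyP] and
   [maximal_topology_unique]. *)
Definition conv_topology l : set (set X) := xget set0 (maximal_topology l).

Let seq_open l : set (set X) :=
  [set U | forall x a, l x a -> U a -> \forall n \near \oo, U (x n)].

Let seq_open_topology l : is_topology (seq_open l).
Proof.
split=> [x a _ _|U V oU oV x a xa [Ua Va]|F oF x a xa [U FU Ua]].
- by exists 0.
- have [m _ Um] := oU _ _ xa Ua; have [n _ Vn] := oV _ _ xa Va.
  exists (maxn m n) => // k /=; rewrite geq_max => /andP[mk nk].
  by split; [exact: Um|exact: Vn].
- by have [m _ Um] := oF _ FU _ _ xa Ua; exists m => // k /Um; exists U.
Qed.

Let seq_open_le l : conv_le l (top_lim (seq_open l)).
Proof.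
move=> x a xa U [V [oV Va VU]]; have [m _ Vm] := oV _ _ xa Va.
by exists m => // k /Vm /VU.
Qed.

Let seq_open_max l O :
  is_topology O -> conv_le l (top_lim O) -> O `<=` seq_open l.
Proof. by move=> _ lO U OU x a xa Ua; apply: lO xa _ _; exists U; split. Qed.

Lemma maximal_topology_unique l O1 O2 :
  maximal_topology l O1 -> maximal_topology l O2 -> O1 = O2.
Proof.
have seqE O : maximal_topology l O -> seq_open l = O.
  case=> tO lO; apply; [exact: seq_open_topology|exact: seq_open_le|].
  exact: seq_open_max.
by move=> /seqE <- /seqE.
Qed.

Lemma maximal_topologyP l : maximal_topology l (conv_topology l).
Proof.
rewrite /conv_topology; apply: xgetPex; exists (seq_open l).
split; [exact: seq_open_topology|exact: seq_open_le|].
move=> O tO lO sO; apply/seteqP; split=> //; exact: seq_open_max.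
Qed.

End Convergence.

Section BooleanAlgebra.
Context {d : Order.disp_t} {B : ctbDistrLatticeType d}.
Implicit Types (S : set B) (x : nat -> B).

Definition bsup S : B := supremum \bot%O S.
Definition binf S : B := infimum \top%O S.

Definition bliminf x : B :=
  bsup [set binf [set x n | n in [set n | (k <= n)%N]] | k in [set: nat]].

Definition blimsup x : B :=
  binf [set bsup [set x n | n in [set n | (k <= n)%N]] | k in [set: nat]].

Definition lambda_ls : convergence B := fun x => [set b | (blimsup x <= b)%O].

Definition lambda_li : convergence B := fun x => [set b | (b <= bliminf x)%O].

(* Since liminf x <= limsup x, this is {a} when both are equal to a, and empty
   when liminf x < limsup x. *)
Definition lambda_s : convergence B := fun x =>
  [set a | bliminf x = a /\ blimsup x = a].

Definition O_s : set (set B) := conv_topology lambda_s.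
Definition O_ls : set (set B) := conv_topology lambda_ls.
Definition O_li : set (set B) := conv_topology lambda_li.
Definition O_lsi : set (set B) := smallest is_topology (O_ls `|` O_li).

End BooleanAlgebra.

Definition complete {d : Order.disp_t} (B : ctbDistrLatticeType d) : Prop :=
  forall S : set B, supremums S !=set0 /\ infimums S !=set0.

Arguments lambda_s {d} B.
Arguments lambda_ls {d} B.
Arguments lambda_li {d} B.
Arguments O_s {d} B.
Arguments O_ls {d} B.
Arguments O_li {d} B.
Arguments O_lsi {d} B.

(* Main.v *)
(* The only inclusion that is not formal is lim_{O_s} <= (lambda_s)*, which holds
   for every convergence admitting constants and subsequences and having unique
   limits: if y converges to a in the sequential topology and never takes the
   value a, then range y is not closed, so some subsequence y o k converges to
   some b; the set {b} + range (y o k) is closed by uniqueness of limits, hence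
   contains a, and b = a.  The strict inclusions are all witnessed by a constant
   sequence, the topological ones because B \ {0} is O_li-open and B \ {1} is
   O_ls-open. *)
Require Import Defs.
From mathcomp Require Import all_boot all_order.
From mathcomp Require Import boolp classical_sets filter.

Import Order.TTheory.

Local Open Scope classical_set_scope.

(** * Extraction of subsequences of natural numbers *)

Lemma strictly_increasing_comp (f g : nat -> nat) :
  strictly_increasing f -> strictly_increasing g ->
  strictly_increasing (f \o g).
Proof. by move=> fP gP m n mn; apply/fP/gP. Qed.

Lemma strictly_increasing_ge (f : nat -> nat) (n : nat) :
  strictly_increasing f -> n <= f n.
Proof. by move=> fP; elim: n => // n /leq_ltn_trans; apply; apply: fP. Qed.

(** Dependent choice: iterate from [0] a function that picks a later [R]-successor. *)
Lemma exists_strictly_increasing (R : nat -> nat -> Prop) :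
  (forall m, exists2 n, m < n & R m n) ->
  exists2 f, strictly_increasing f & forall n, R (f n) (f n.+1).
Proof.
move=> /(_ _)/cid2 nextR; exists (fun n => iter n (fun m => s2val (nextR m)) 0).
  by apply: homo_ltn => [? ? ?|n]; [exact: ltn_trans|exact: s2valP (nextR _)].
by move=> n; exact: s2valP' (nextR _).
Qed.

Lemma frequently_subseq (P : set nat) :
  ~ (\forall n \near \oo, ~ P n) ->
  exists2 f, strictly_increasing f & forall n, P (f n).
Proof.
move=> nP.
have [|f fP Pf] := exists_strictly_increasing (fun _ n => P n).
  move=> m; apply: contra_notP nP => nP; exists m.+1 => // n /= mn Pn.
  by apply: nP; exists n.
(* The starting point [f 0] need not satisfy [P], so the sequence is shifted by one. *)
exists (f \o succn) => // m n mn; exact: fP.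
Qed.

Lemma not_eventually_subseq (P : set nat) :
  ~ (\forall n \near \oo, P n) ->
  exists2 f, strictly_increasing f & forall n, ~ P (f n).
Proof.
move=> nP; apply: (frequently_subseq (fun n => ~ P n)).
by apply: contra_not nP => -[m _ Pm]; exists m => // n /Pm /contrapT.
Qed.

(** If no value is taken infinitely often, then [k] tends to infinity, and indices with ever larger
    values can be chosen one after the other. *)
Lemma constant_or_increasing_subseq (k : nat -> nat) :
  (exists j, exists2 g, strictly_increasing g & forall n, k (g n) = j) \/
  (exists2 g, strictly_increasing g & strictly_increasing (k \o g)).
Proof.
have [[j jk]|nk] := pselect (exists j, ~ \forall n \near \oo, k n <> j).
  by left; exists j; exact: (frequently_subseq (fun n => k n = j)).
have tok M : \forall n \near \oo, M < k n.
  have avoid j : \forall n \near \oo, k n <> j.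
    by apply: contrapT => jk; apply: nk; exists j.
  elim: M => [|M [m _ Mm]].
    by have [m _ mk] := avoid 0; exists m => // n /mk /eqP; rewrite lt0n.
  have [p _ pk] := avoid M.+1; exists (maxn m p) => // n /=.
  rewrite geq_max => /andP[/Mm Mk /pk /eqP nM].
  by rewrite ltn_neqAle eq_sym nM.
right; have [|g gP kg] := exists_strictly_increasing (fun m n => k m < k n).
  move=> m; have [p _ pk] := tok (k m).
  by exists (maxn m.+1 p); [exact: leq_maxl|exact: pk (leq_maxr _ _)].
exists g => //; apply: (@homo_ltn _ (k \o g) (fun m n => m < n)) => //.
by move=> ? ? ?; exact: ltn_trans.
Qed.

(** * Convergences, their star and their sequential topologies *)

Section Convergence.
Context {X : Type}.
Implicit Types (l : convergence X) (O : set (set X)) (x y : nat -> X).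

Definition conv_const l : Prop := forall a, l (fun=> a) a.

Definition conv_subseq l : Prop := forall x f,
  strictly_increasing f -> l x `<=` l (x \o f).

Definition conv_hausdorff l : Prop := forall x a b, l x a -> l x b -> a = b.

Lemma conv_le_antisym l1 l2 : conv_le l1 l2 -> conv_le l2 l1 -> l1 = l2.
Proof. by move=> l12 l21; apply: funext => x; apply/seteqP; split. Qed.

Lemma conv_ltP l1 l2 : conv_lt l1 l2 <-> conv_le l1 l2 /\ ~ conv_le l2 l1.
Proof.
split=> -[l12 l21]; split=> //; last by move=> l12E; move: l12 l21; rewrite l12E.
by apply: contra_not l21; exact: conv_le_antisym.
Qed.

Lemma conv_lt_cap l1 l2 :
  ~ conv_le l1 l2 -> conv_lt (conv_cap l1 l2) l1.
Proof.
by move=> nl; apply/conv_ltP; split=> [x a []//|le]; apply: nl => x a /le[].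
Qed.

Lemma conv_capC l1 l2 : conv_cap l1 l2 = conv_cap l2 l1.
Proof. by apply: funext => x; rewrite /conv_cap setIC. Qed.

Lemma conv_star_le l1 l2 :
  conv_le l1 l2 -> conv_le (conv_star l1) (conv_star l2).
Proof.
move=> l12 x a xa f /xa[g gP ga]; exists g => //; exact: l12.
Qed.

Lemma le_conv_star l : conv_subseq l -> conv_le l (conv_star l).
Proof. by move=> lS x a xa f fP; exists id => //; exact: lS xa. Qed.

(** Thin out twice: first for [l1], then, along the result, for [l2]. The second thinning keeps the
    [l1]-limit because [l1] passes to subsequences. *)
Lemma conv_star_cap l1 l2 : conv_subseq l1 -> conv_subseq l2 ->
  conv_cap (conv_star l1) (conv_star l2) = conv_star (conv_cap l1 l2).
Proof.
move=> l1S l2S; apply: conv_le_antisym => x a; last first.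
  by move=> xa; split=> f /xa[g gP []] *; exists g.
move=> [xa1 xa2] f fP; have [g gP l1a] := xa1 f fP.
have [h hP l2a] := xa2 _ (strictly_increasing_comp _ _ fP gP).
exists (g \o h); first exact: strictly_increasing_comp.
by split=> //; exact: l1S l1a.
Qed.

Lemma top_limP O x a :
  top_lim O x a <-> forall U, O U -> U a -> \forall n \near \oo, U (x n).
Proof.
split=> [xa U OU Ua|xa U [V [OV Va VU]]]; first by apply: xa; exists U; split.
by have [m _ Vm] := xa V OV Va; exists m => // n /Vm /VU.
Qed.

Lemma top_lim_anti O1 O2 : O1 `<=` O2 -> conv_le (top_lim O2) (top_lim O1).
Proof. by move=> O12 x a /top_limP xa; apply/top_limP => U /O12; exact: xa. Qed.

Lemma top_lim_subseq O : conv_subseq (top_lim O).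
Proof.
move=> x f fP a xa U /xa[m _ Um]; exists m => // n mn; apply: Um.
exact: leq_trans mn (strictly_increasing_ge f n fP).
Qed.

(** This is the finest topology in which [x] converges to [a], so [x] converges to [a] in exactly
    the topologies contained in it. Convergence in a generated topology can therefore be tested on
    the generators. *)
Lemma is_topology_lim_open x a :
  is_topology [set U | U a -> \forall n \near \oo, U (x n)].
Proof.
split=> [_|U V oU oV [/oU[m _ Um] /oV[n _ Vn]]|F oF [U FU Ua]].
- by exists 0.
- by exists (maxn m n) => // k /=; rewrite geq_max => /andP[/Um ? /Vn].
- by have [m _ Um] := oF _ FU Ua; exists m => // k /Um; exists U.
Qed.

Lemma top_lim_smallest O1 O2 :
  top_lim (smallest is_topology (O1 `|` O2))
  = conv_cap (top_lim O1) (top_lim O2).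
Proof.
apply: conv_le_antisym => x a.
  by move=> xa; split; apply: top_lim_anti xa => U OU;
    apply: sub_gen_smallest; [left|right].
move=> [/top_limP xa1 /top_limP xa2]; apply/top_limP => U OU.
apply: (OU [set V | V a -> \forall n \near \oo, V (x n)]).
split; first exact: is_topology_lim_open.
by move=> V [/xa1|/xa2].
Qed.

Lemma is_topology_conv_topology l : is_topology (conv_topology l).
Proof. by have [] := maximal_topologyP l. Qed.

Lemma le_top_lim l : conv_le l (top_lim (conv_topology l)).
Proof. by have [] := maximal_topologyP l. Qed.

(** The sets on the right form a topology, being the intersection of the finest topologies attached
    to all pairs with [l x a]. It contains [conv_topology l] and makes [l] convergent, so maximality
    identifies the two. *)
Lemma conv_topologyP l U : conv_topology l U <->
  forall x a, l x a -> U a -> \forall n \near \oo, U (x n).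
Proof.
split=> [OU x a xa Ua|oU]; first by have /top_limP := le_top_lim l x a xa; apply.
have [tO lO maxO] := maximal_topologyP l.
pose O' := [set V | forall x a, l x a -> V a -> \forall n \near \oo, V (x n)].
suff <- : O' = conv_topology l by [].
apply: maxO => [|x a xa|V OV x a xa Va].
- split=> [x a _ _|V W oV oW x a xa|F oF x a xa].
  + by exists 0.
  + by have [_ + _] := is_topology_lim_open x a; apply; [exact: oV|exact: oW].
  + have [_ _ +] := is_topology_lim_open x a; apply=> V FV; exact: oF.
- by apply/top_limP => V oV; exact: oV.
- by have /top_limP := lO x a xa; apply.
Qed.

Lemma conv_topology_anti l1 l2 :
  conv_le l1 l2 -> conv_topology l2 `<=` conv_topology l1.
Proof.
by move=> l12 U /conv_topologyP OU; apply/conv_topologyP => x a /l12; exact: OU.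
Qed.

(** If [x] left an open [U] around [a] infinitely often, a subsequence would avoid [U], yet a
    further subsequence has [a] as an [l]-limit and must enter [U]. *)
Lemma conv_star_le_top_lim l :
  conv_le (conv_star l) (top_lim (conv_topology l)).
Proof.
move=> x a xa; apply/top_limP => U OU Ua; apply: contrapT.
move=> /not_eventually_subseq[f fP nU]; have [g gP la] := xa f fP.
by have /conv_topologyP/(_ _ _ la Ua)[m _ /(_ m (leqnn m))] := OU; exact: nU.
Qed.

(** Sequentially closed sets are closed: a sequence that is not eventually outside [A] has a
    subsequence inside [A], and this keeps the limit. *)
Lemma conv_topology_setC l (A : set X) : conv_subseq l ->
  (forall z c, l z c -> (forall n, A (z n)) -> A c) -> conv_topology l (~` A).
Proof.
move=> lS clA; apply/conv_topologyP => x a xa nAa; apply: contrapT.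
move=> /not_eventually_subseq[f fP Axf]; apply: nAa.
by apply: clA (lS _ _ fP _ xa) _ => n; apply: contrapT; exact: Axf.
Qed.

(** Write [z] as [y \o k]. Where [k] is constant along a subsequence, [c] is a value of [y] by
    uniqueness of limits; where [k] increases, [z] contains a subsequence of [y]. *)
Lemma conv_range l y z c :
    conv_const l -> conv_subseq l -> conv_hausdorff l ->
    l z c -> (forall n, range y (z n)) ->
  range y c \/ exists2 k, strictly_increasing k & l (y \o k) c.
Proof.
move=> l1 lS lH zc zy.
have /choice[k yk] n : exists j, y j = z n by have [j _ <-] := zy n; exists j.
have zE : z = y \o k by apply: funext => n; rewrite /= yk.
have [[j [g gP kj]]|[g gP kgP]] := constant_or_increasing_subseq k.
  left; exists j => //; apply: lH (lS _ _ gP _ zc).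
  suff -> : z \o g = fun=> y j by [].
  by apply: funext => n /=; rewrite zE /= kj.
by right; exists (k \o g) => //; move: (lS _ _ gP _ zc); rewrite zE.
Qed.

Lemma top_lim_le_conv_star l :
  conv_const l -> conv_subseq l -> conv_hausdorff l ->
  conv_le (top_lim (conv_topology l)) (conv_star l).
Proof.
move=> l1 lS lH x a xa f fP.
(* If [x \o f] takes the value [a] infinitely often, a constant subsequence already has limit [a].
   Otherwise the shift [s] drops the finitely many terms equal to [a]. *)
have [nya|] := pselect (\forall n \near \oo, (x \o f) n <> a); last first.
  move=> /frequently_subseq[g gP ya]; exists g => //.
  suff -> : x \o f \o g = fun=> a by [].
  by apply: funext.
have [m _ ma] := nya; pose s n := m + n.
have sP : strictly_increasing s by move=> p q pq; rewrite ltn_add2l.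
pose y := x \o f \o s.
have ya : top_lim (conv_topology l) y a.
  by apply: (top_lim_subseq _ _ _ sP); exact: top_lim_subseq.
have yNa n : y n <> a by apply: ma; exact: leq_addr.
have [k kP [b yb]] : exists2 k, strictly_increasing k & l (y \o k) !=set0.
  apply: contrapT => nk.
  have oU : conv_topology l (~` range y).
    apply: conv_topology_setC => // z c zc yz.
    have [//|[k kP kc]] := conv_range _ _ _ _ l1 lS lH zc yz.
    by case: nk; exists k => //; exists c.
  have [|p _ /(_ p (leqnn p))] := (top_limP _ _ _).1 ya _ oU.
    by case=> n _ /yNa.
  by apply; exists p.
suff ba : b = a.
  exists (s \o k); first exact: strictly_increasing_comp.
  by rewrite -ba.
apply: contrapT => bNa.
have oU : conv_topology l (~` ([set b] `|` range (y \o k))).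
  apply: conv_topology_setC => // z c zc Fz.
  (* If [z] eventually differs from [b], its tail from [q] on lies in the range of [y \o k], so [c]
     is in that range or is the limit [b] of a subsequence. If [z] equals [b] infinitely often, then
     [c = b]. *)
  have [[q _ zNb]|/frequently_subseq[g gP zg]] :=
    pselect (\forall n \near \oo, z n <> b).
    have [|n|yc|[h hP yc]] := conv_range _ (y \o k) (z \o addn q) c l1 lS lH.
    - by apply: (lS _ _ _ _ zc) => i j ij; rewrite ltn_add2l.
    - by have [/zNb|] := Fz (q + n); first by case; exact: leq_addr.
    - by right.
    - by left; apply: lH yc _; exact: lS yb.
  left; apply: (lH _ _ _ (lS _ _ gP _ zc)).
  suff -> : z \o g = fun=> b by exact: l1.
  exact: funext.
(* Were [a] different from [b], [y] would eventually avoid the closed set, but its term at index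
   [k p], with [p <= k p], lies in it. *)
have /(_ _ )[|p _ /(_ _ (strictly_increasing_ge k p kP))] :=
    (top_limP _ _ _).1 ya _ oU.
  by move=> [/esym|[n _ /yNa]].
by apply; right; exists p.
Qed.

End Convergence.

(** * Lower and upper limits in a complete Boolean algebra *)

Section BooleanAlgebra.
Context {d : Order.disp_t} {B : ctbDistrLatticeType d}.
Context (completeB : complete B) (nontrivialB : (\bot%O : B) <> \top%O).
Implicit Types (S : set B) (x : nat -> B) (a b : B).

Lemma bsup_supremums S : supremums S (bsup S).
Proof.
(* On the empty set [supremum] returns its default [\bot], which is indeed the least upper bound. *)
rewrite /bsup /supremum; case: ifPn => [/eqP ->|_].
  by split=> // b _; exact: le0x.
by have [[b Sb] _] := completeB S; exact: xgetPex (ex_intro _ b Sb).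
Qed.

Lemma binf_infimums S : infimums S (binf S).
Proof.
rewrite /binf /infimum; case: ifPn => [/eqP ->|_].
  by split=> // b _; exact: lex1.
by have [_ [b Sb]] := completeB S; exact: xgetPex (ex_intro _ b Sb).
Qed.

(** The lower limit is the supremum of all lower bounds of tails. Quantifying over such bounds [c]
    removes the nested infimum from every later argument. *)
Lemma bliminf_leP x b :
  (bliminf x <= b)%O <->
  forall k c, (forall n, k <= n -> (c <= x n)%O) -> (c <= b)%O.
Proof.
split=> [xb k c cx|xb].
  apply: le_trans xb; have [+ _] := bsup_supremums
    [set binf [set x n | n in [set n | k <= n]] | k in [set: nat]].
  move=> /(_ _ (ex_intro2 _ _ k I erefl)); apply: le_trans.
  have [_ +] := binf_infimums [set x n | n in [set n | k <= n]].
  by apply=> _ [n /cx ? <-].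
have [_ +] := bsup_supremums
  [set binf [set x n | n in [set n | k <= n]] | k in [set: nat]].
apply=> _ [k _ <-]; apply: (xb k) => n kn.
have [+ _] := binf_infimums [set x n | n in [set n | k <= n]].
by apply; exists n.
Qed.

Lemma le_blimsupP x b :
  (b <= blimsup x)%O <->
  forall k c, (forall n, k <= n -> (x n <= c)%O) -> (b <= c)%O.
Proof.
split=> [bx k c xc|bx].
  apply: (le_trans bx); have [+ _] := binf_infimums
    [set bsup [set x n | n in [set n | k <= n]] | k in [set: nat]].
  move=> /(_ _ (ex_intro2 _ _ k I erefl)) /le_trans; apply.
  have [_ +] := bsup_supremums [set x n | n in [set n | k <= n]].
  by apply=> _ [n /xc ? <-].
have [_ +] := binf_infimums
  [set bsup [set x n | n in [set n | k <= n]] | k in [set: nat]].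
apply=> _ [k _ <-]; apply: (bx k) => n kn.
have [+ _] := bsup_supremums [set x n | n in [set n | k <= n]].
by apply; exists n.
Qed.

Lemma le_bliminf_of x b k : (forall n, k <= n -> (b <= x n)%O) ->
  (b <= bliminf x)%O.
Proof. exact: ((bliminf_leP x _).1 (lexx _)). Qed.

Lemma blimsup_le_of x b k : (forall n, k <= n -> (x n <= b)%O) ->
  (blimsup x <= b)%O.
Proof. exact: ((le_blimsupP x _).1 (lexx _)). Qed.

(** Any two tails share a term, here the one at [maxn k m], which separates a lower bound of one
    from an upper bound of the other. *)
Lemma bliminf_le_blimsup x : (bliminf x <= blimsup x)%O.
Proof.
apply/bliminf_leP => k b bx; apply/le_blimsupP => m c xc.
exact: le_trans (bx _ (leq_maxl k m)) (xc _ (leq_maxr k m)).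
Qed.

Lemma bliminf_subseq x f : strictly_increasing f ->
  (bliminf x <= bliminf (x \o f))%O.
Proof.
move=> fP; apply/bliminf_leP => k b bx; apply: (le_bliminf_of _ _ k) => n kn.
by apply: bx; exact: leq_trans kn (strictly_increasing_ge _ _ fP).
Qed.

Lemma blimsup_subseq x f : strictly_increasing f ->
  (blimsup (x \o f) <= blimsup x)%O.
Proof.
move=> fP; apply/le_blimsupP => k b xb; apply: (blimsup_le_of _ _ k) => n kn.
by apply: xb; exact: leq_trans kn (strictly_increasing_ge _ _ fP).
Qed.

Lemma bliminf_const a : bliminf (fun=> a) = a.
Proof.
apply/le_anti/andP; split; last exact: (le_bliminf_of _ _ 0).
by apply/bliminf_leP => k c /(_ k (leqnn k)).
Qed.

Lemma blimsup_const a : blimsup (fun=> a) = a.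
Proof.
apply/le_anti/andP; split; first exact: (blimsup_le_of _ _ 0).
by apply/le_blimsupP => k c /(_ k (leqnn k)).
Qed.

Lemma conv_const_s : conv_const (lambda_s B).
Proof. by move=> a; split; [exact: bliminf_const|exact: blimsup_const]. Qed.

Lemma conv_hausdorff_s : conv_hausdorff (lambda_s B).
Proof. by move=> x a b [<- _] [<- _]. Qed.

Lemma conv_subseq_ls : conv_subseq (lambda_ls B).
Proof. by move=> x f fP a; apply: le_trans; exact: blimsup_subseq. Qed.

Lemma conv_subseq_li : conv_subseq (lambda_li B).
Proof. by move=> x f fP a /le_trans; apply; exact: bliminf_subseq. Qed.

(** A common limit [a] closes the cycle limsup, [a], liminf, limsup of inequalities, so all three
    coincide. *)
Lemma conv_cap_ls_li : conv_cap (lambda_ls B) (lambda_li B) = lambda_s B.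
Proof.
apply: conv_le_antisym => x a; last first.
  by move=> [il sl]; split; rewrite /lambda_ls /lambda_li /= ?il ?sl.
move=> [sa ai]; have si := bliminf_le_blimsup x.
by split; apply/le_anti/andP; split=> //; [exact: le_trans sa|exact: le_trans si].
Qed.

Lemma conv_subseq_s : conv_subseq (lambda_s B).
Proof.
rewrite -conv_cap_ls_li => x f fP a [sa ai].
by split; [exact: conv_subseq_ls sa|exact: conv_subseq_li ai].
Qed.

Lemma open_li_neq0 : O_li B (~` [set \bot%O]).
Proof.
apply: conv_topology_setC; first exact: conv_subseq_li.
move=> z c cz z0; apply/le_anti; rewrite le0x andbT; apply: le_trans cz _.
by apply/bliminf_leP => k b /(_ k (leqnn k)); rewrite z0.
Qed.

Lemma open_ls_neq1 : O_ls B (~` [set \top%O]).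
Proof.
apply: conv_topology_setC; first exact: conv_subseq_ls.
move=> z c zc z1; apply/le_anti; rewrite lex1 /=; apply: le_trans zc.
by apply/le_blimsupP => k b /(_ k (leqnn k)); rewrite z1.
Qed.

Lemma not_top_lim_li01 : ~ top_lim (O_li B) (fun=> \bot%O) \top%O.
Proof.
move=> /top_limP/(_ _ open_li_neq0)[|m _ /(_ m (leqnn m))]; last by apply.
exact/nesym.
Qed.

Lemma not_top_lim_ls10 : ~ top_lim (O_ls B) (fun=> \top%O) \bot%O.
Proof.
by move=> /top_limP/(_ _ open_ls_neq1)[|m _ /(_ m (leqnn m))]; last apply.
Qed.

(** Every element, in particular [\top], is a [lambda_ls]-limit of the constant sequence [\bot].
    Allowing any [l1] and [l2] within these bounds covers the convergences, their stars and the
    topological limits at once. *)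
Lemma not_conv_le_ls_li (l1 l2 : convergence B) :
  conv_le (lambda_ls B) l1 -> conv_le l2 (top_lim (O_li B)) -> ~ conv_le l1 l2.
Proof.
move=> sl1 l2i l12; apply: not_top_lim_li01; apply/l2i/l12/sl1.
by rewrite /lambda_ls /= lex1.
Qed.

Lemma not_conv_le_li_ls (l1 l2 : convergence B) :
  conv_le (lambda_li B) l1 -> conv_le l2 (top_lim (O_ls B)) -> ~ conv_le l1 l2.
Proof.
move=> il1 l2s l12; apply: not_top_lim_ls10; apply/l2s/l12/il1.
by rewrite /lambda_li /= le0x.
Qed.

Lemma conv_lt_cap_ls_li (ls li : convergence B) :
    conv_le (lambda_ls B) ls -> conv_le ls (top_lim (O_ls B)) ->
    conv_le (lambda_li B) li -> conv_le li (top_lim (O_li B)) ->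
  conv_lt (conv_cap ls li) ls /\ conv_lt (conv_cap ls li) li.
Proof.
move=> ls_ge ls_le li_ge li_le; split; last rewrite conv_capC.
  exact/conv_lt_cap/not_conv_le_ls_li.
exact/conv_lt_cap/not_conv_le_li_ls.
Qed.

End BooleanAlgebra.

Theorem theorem3p1 (d : Order.disp_t) (B : ctbDistrLatticeType d)
    (completeB : complete B) (nontrivialB : (\bot%O : B) <> (\top%O : B)) :
  ([/\ conv_le (lambda_s B) (lambda_ls B),
       conv_le (lambda_s B) (lambda_li B),
       conv_le (lambda_s B) (conv_star (lambda_s B)) &
       conv_star (lambda_s B) = top_lim (O_s B)] /\
   [/\ conv_le (lambda_ls B) (conv_star (lambda_ls B)),
       conv_le (conv_star (lambda_ls B)) (top_lim (O_ls B)),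
       conv_le (lambda_li B) (conv_star (lambda_li B)) &
       conv_le (conv_star (lambda_li B)) (top_lim (O_li B))] /\
   [/\ conv_le (conv_star (lambda_s B)) (conv_star (lambda_ls B)),
       conv_le (conv_star (lambda_s B)) (conv_star (lambda_li B)),
       conv_le (conv_star (lambda_s B)) (top_lim (O_lsi B)),
       conv_le (top_lim (O_lsi B)) (top_lim (O_ls B)) &
       conv_le (top_lim (O_lsi B)) (top_lim (O_li B))]) /\
  [/\ O_ls B `<=` O_lsi B, O_li B `<=` O_lsi B & O_lsi B `<=` O_s B] /\
  [/\ conv_cap (lambda_ls B) (lambda_li B) = lambda_s B,
      conv_cap (conv_star (lambda_ls B)) (conv_star (lambda_li B))
        = conv_star (lambda_s B) &
      conv_cap (top_lim (O_ls B)) (top_lim (O_li B)) = top_lim (O_lsi B)] /\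
  ([/\ conv_lt (lambda_s B) (lambda_ls B) & conv_lt (lambda_s B) (lambda_li B)] /\
   [/\ conv_lt (conv_star (lambda_s B)) (conv_star (lambda_ls B)) &
       conv_lt (conv_star (lambda_s B)) (conv_star (lambda_li B))] /\
   [/\ conv_lt (top_lim (O_lsi B)) (top_lim (O_ls B)) &
       conv_lt (top_lim (O_lsi B)) (top_lim (O_li B))] /\
   [/\ O_ls B `<` O_lsi B & O_li B `<` O_lsi B]).
Proof.
have tlsi : conv_cap (top_lim (O_ls B)) (top_lim (O_li B)) = top_lim (O_lsi B).
  by rewrite -top_lim_smallest.
have s_cap := conv_cap_ls_li completeB.
have lsS := conv_subseq_ls completeB; have liS := conv_subseq_li completeB.
have sS := conv_subseq_s completeB.
have star_cap := conv_star_cap _ _ lsS liS; rewrite s_cap in star_cap.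
have s_ls : conv_le (lambda_s B) (lambda_ls B) by rewrite -s_cap => x a [].
have s_li : conv_le (lambda_s B) (lambda_li B) by rewrite -s_cap => x a [].
have ls_star := le_conv_star _ lsS; have li_star := le_conv_star _ liS.
have ls_top := conv_star_le_top_lim (lambda_ls B).
have li_top := conv_star_le_top_lim (lambda_li B).
have s_lim : conv_star (lambda_s B) = top_lim (O_s B).
  apply: conv_le_antisym; first exact: conv_star_le_top_lim.
  exact: top_lim_le_conv_star (conv_const_s completeB) sS conv_hausdorff_s.
have ls_lsi : O_ls B `<=` O_lsi B.
  by move=> U OU; apply: sub_gen_smallest; left.
have li_lsi : O_li B `<=` O_lsi B.
  by move=> U OU; apply: sub_gen_smallest; right.
have lsi_s : O_lsi B `<=` O_s B.
  apply: smallest_sub; first exact: is_topology_conv_topology.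
  by move=> U [|]; exact: conv_topology_anti.
(* The strictness argument is used at three levels: the convergences themselves, their stars, and
   the topological limits. *)
have [s_lt1 s_lt2] := conv_lt_cap_ls_li completeB nontrivialB
  _ _ (fun _ _ => id) (le_top_lim _) (fun _ _ => id) (le_top_lim _).
have [star_lt1 star_lt2] := conv_lt_cap_ls_li completeB nontrivialB
  _ _ ls_star ls_top li_star li_top.
have [lim_lt1 lim_lt2] := conv_lt_cap_ls_li completeB nontrivialB
  _ _ (le_top_lim _) (fun _ _ => id) (le_top_lim _) (fun _ _ => id).
rewrite s_cap in s_lt1 s_lt2; rewrite star_cap in star_lt1 star_lt2.
rewrite tlsi in lim_lt1 lim_lt2.
have lt_lim (O : set (set B)) :
    O `<=` O_lsi B -> conv_lt (top_lim (O_lsi B)) (top_lim O) -> O `<` O_lsi B.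
  (* The reverse inclusion of topologies would reverse the inequality of limits, which is excluded
     by strictness. *)
  by move=> sub /conv_ltP[_ nle]; split=> // /top_lim_anti.
split; [split; [|split]|split; [|split; [|split; [|split; [|split]]]]] => //.
- by split=> //; exact: le_conv_star.
- split; [exact: conv_star_le|exact: conv_star_le| | |].
  + by rewrite s_lim; exact: top_lim_anti.
  + exact: top_lim_anti.
  + exact: top_lim_anti.
- by split; exact: lt_lim.
Qed.
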